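(* Let $k$ be a field of arbitrary characteristic, let $n\ge 2$, let $R=k[x_1,\ldots,x_n,y_1,\ldots,y_n]$, and let $G$ be a graph on $n$ vertices, with vertex set $\{1,\ldots,n\}$. Then the binomial edge ideal $\mathcal{J}(G)$ is of König type if and only if $G$ is $\mathsf{LF}$-coverable. Furthermore, for $S\subseteq V(G)$, whether $(F,S)$ is an $\mathsf{LF}$-cover of $G$ is independent of the choice of maximal linear forest $F$ in $G$; that is, if $F$ and $F'$ are maximal linear forests in $G$, then $(F,S)$ is an $\mathsf{LF}$-cover of $G$ if and only if $(F',S)$ is an $\mathsf{LF}$-cover of $G$.
   Context: All graphs are finite, simple and undirected; $V(G)$ and $E(G)$ denote the vertex and edge sets. Binomial edge ideal: with $\delta_{i,j}=x_iy_j-x_jy_i$ for $1\le i<j\le n$, set $\mathcal{J}(G)=(\delta_{i,j}:\{i,j\}\in E(G))\subseteq R$. A linear forest is a graph every connected component of which is a path (a single vertex is a path). A linear forest in $G$ is a subgraph of $G$ that is a linear forest; it is called maximal if no other linear forest in $G$ has a greater number of edges. $\mathsf{LF}(G)$ denotes the number of edges of a maximal linear forest in $G$. $\mathcal{J}(G)$ is of König type if $\operatorname{grade}_R(\mathcal{J}(G))=\mathsf{LF}(G)$. $\mathsf{LF}$-cover: let $F$ be a maximal linear forest in $G$ and $S\subseteq V(F)$. The pair $(F,S)$ is an $\mathsf{LF}$-cover of $G$ if: (1) no vertex in $S$ is a leaf of $F$, where a leaf of $F$ means a vertex of degree at most $1$ in $F$ (so isolated vertices of $F$ count as leaves); (2)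 no two vertices in $S$ are adjacent in $F$; (3) for every edge $\{i,j\}\in E(G)$, either at least one of $i,j$ belongs to $S$, or both $i$ and $j$ belong to the same connected component of $F\setminus S$. $G$ is $\mathsf{LF}$-coverable if it has an $\mathsf{LF}$-cover. *)

(* Defs.v *)
From HB Require Import structures.
From mathcomp Require Import all_boot all_order all_algebra.
From mathcomp Require Import mpoly.

Set Implicit Arguments.
Unset Strict Implicit.
Unset Printing Implicit Defensive.

Import GRing.Theory.

Local Open Scope ring_scope.

Section Graphs.
Variable T : finType.

(* Finite simple graphs with vertices in T: a vertex set together with a set  *)
(* of two-element subsets of it.  The vertex set need not be all of T, so     *)
(* subgraphs, components and vertex deletions are again graphs of this type.  *)
Definition graph_axiom (VE : {set T} * {set {set T}}) : bool :=
  [forall e in VE.2, (#|e| == 2) && (e \subset VE.1)].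

Record graph := Graph { gval : {set T} * {set {set T}}; _ : graph_axiom gval }.

HB.instance Definition _ := [isSub for gval].
HB.instance Definition _ := [Finite of graph by <:].

Definition verts (G : graph) : {set T} := (gval G).1.
Definition edges (G : graph) : {set {set T}} := (gval G).2.

Definition adj (G : graph) : rel T := [rel x y | [set x; y] \in edges G].

Definition degree (G : graph) (v : T) : nat := #|[set w | adj G v w]|.

Definition subgraph (H G : graph) : bool :=
  (verts H \subset verts G) && (edges H \subset edges G).

Lemma induced_subproof (G : graph) (A : {set T}) :
  graph_axiom (verts G :&: A, [set e in edges G | e \subset A]).
Proof.
apply/forall_inP => e /=; rewrite inE => /andP[eG eA].
have /forall_inP /(_ e eG) /andP[-> eV] := valP G.
by rewrite subsetI eV eA.
Qed.

Definition induced (G : graph) (A : {set T}) : graph :=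
  Graph (induced_subproof G A).

Definition delete (G : graph) (S : {set T}) : graph := induced G (~: S).

Definition same_component (G : graph) (x y : T) : bool :=
  [&& x \in verts G, y \in verts G & connect (adj G) x y].

Definition component (G : graph) (x : T) : graph :=
  induced G [set y | same_component G x y].

(* The vertices can be listed without repetition as t_0, ..., t_(m-1), with   *)
(* m > 0, so that the edges are exactly the {t_l, t_(l+1)}.                   *)
Definition is_path (G : graph) : bool :=
  (0 < #|verts G|)%N &&
  [exists t : #|verts G|.-tuple T,
    [&& uniq t, [set x in t] == verts G &
        edges G == [set [set p.1; p.2] | p in zip t (behead t)]]].

Definition linear_forest (F : graph) : bool :=
  [forall x in verts F, is_path (component F x)].

Definition linear_forest_in (G F : graph) : bool :=
  subgraph F G && linear_forest F.

Definition maximal_linear_forest (G F : graph) : Prop :=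
  linear_forest_in G F /\
  forall F' : graph, linear_forest_in G F' -> (#|edges F'| <= #|edges F|)%N.

Definition LF (G : graph) : nat :=
  \max_(F : graph | linear_forest_in G F) #|edges F|.

Definition leaf (F : graph) (v : T) : bool :=
  (v \in verts F) && (degree F v <= 1)%N.

Definition LF_cover (G F : graph) (S : {set T}) : Prop :=
  [/\ maximal_linear_forest G F,
      S \subset verts F,
      forall v, v \in S -> ~~ leaf F v,
      forall u v, u \in S -> v \in S -> ~~ adj F u v &
      forall i j, adj G i j ->
        [\/ i \in S, j \in S | same_component (delete F S) i j]].

Definition LF_coverable (G : graph) : Prop := exists F S, LF_cover G F S.

End Graphs.

Section Grade.
Variable R : comNzRingType.

(* Ideals are Prop-valued predicates: membership in a finitely generated      *)
(* ideal has no boolean decision procedure over an arbitrary commutative ring.*)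
Definition ideal_gen (A : R -> Prop) (f : R) : Prop :=
  exists s : seq (R * R),
    (forall p, p \in s -> A p.2) /\ f = \sum_(p <- s) p.1 * p.2.

Definition ideal_seq (s : seq R) : R -> Prop := ideal_gen (fun f => f \in s).

(* s_i is a nonzerodivisor on R / (s_0, ..., s_(i-1)) for all i < size s, and *)
(* R / (s) is nonzero.                                                        *)
Definition regular_sequence (s : seq R) : Prop :=
  (forall i, (i < size s)%N -> forall g,
      ideal_seq (take i s) (s`_i * g) -> ideal_seq (take i s) g) /\
  ~ ideal_seq s 1.

(* grade_R(I) = d, the grade being the supremum of the lengths of the         *)
(* R-regular sequences contained in I (intended for proper ideals I).         *)
Definition is_grade (I : R -> Prop) (d : nat) : Prop :=
  (exists s : seq R,
      [/\ regular_sequence s, forall f, f \in s -> I f & size s = d]) /\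
  (forall s : seq R,
      regular_sequence s -> (forall f, f \in s -> I f) -> (size s <= d)%N).

End Grade.

Section BinomialEdgeIdeal.
Variables (k : fieldType) (n : nat).

(* k[x_1, ..., x_n, y_1, ..., y_n]: the first n of the n + n indeterminates   *)
(* are the x_i and the last n are the y_i.                                    *)
Definition xvar (i : 'I_n) : {mpoly k[n + n]} := 'X_(lshift n i).
Definition yvar (i : 'I_n) : {mpoly k[n + n]} := 'X_(rshift n i).

Definition delta (i j : 'I_n) : {mpoly k[n + n]} :=
  xvar i * yvar j - xvar j * yvar i.

Definition binomial_edge_ideal (G : graph 'I_n) : {mpoly k[n + n]} -> Prop :=
  ideal_gen (fun f => exists i j : 'I_n,
    [/\ (i < j)%N, adj G i j & f = delta i j]).

Definition konig_type (G : graph 'I_n) : Prop :=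
  is_grade (binomial_edge_ideal G) (LF G).

End BinomialEdgeIdeal.

(* Main.v *)
Require Import Defs.
From mathcomp Require Import all_boot all_order all_algebra.
From mathcomp Require Import mpoly zify.

Set Implicit Arguments.
Unset Strict Implicit.
Unset Printing Implicit Defensive.

Import GRing.Theory.

(** The proof rests on explicit prime ideals attached to a linear forest [F].
    For a set [T] of vertices let [P_T(F)] be the kernel of the ring morphism
    sending [x_i, y_i] to [0] for [i] in [T], and otherwise [x_i] to [x_i] and
    [y_i] to [x_i y_r], where [r] represents the component of [i] in [F \ T].
    This kernel contains [delta i j] exactly when [i] or [j] lies in [T] or the
    two vertices share a component of [F \ T].  Call [T] a cutset of [F] if it
    consists of inner vertices of [F], no two of them adjacent: these are
    conditions (1) and (2) of an LF-cover, and condition (3) then says that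
    [P_T(F)] contains the binomial edge ideal [J(G)].

    The central fact ([deltas_radical]) is that [J(F)] is the intersection of
    the [P_T(F)] over the cutsets [T].  Orient every edge [u v] of [F] along its
    path.  Rewriting [x_u y_v] to [x_v y_u] brings every monomial to a standard
    form, in which no [x_u y_v] occurs.  On each stretch of consecutive vertices
    a standard monomial uses first only [y]'s, then perhaps one vertex with
    both variables, then only [x]'s; so it is determined by its total degree at
    each vertex and its total [y]-degree on each stretch.  Choosing as cutset
    one vertex in each gap between stretches, the morphism for that cutset
    reads off precisely these data.

    Since the [P_T(F)] are prime, an element outside all of them is a
    nonzerodivisor modulo [J(F)].  For the next edge of a growing forest this
    holds, so the [delta]'s of the edges of [F] form a regular sequence
    ([deltas_regular]), and [J(G)] always contains a regular sequence of length
    [LF(G)].  If no cutset of a maximal linear forest gives a cover, then [J(G)]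
    lies in no [P_T(F)]; by prime avoidance some [g] in [J(G)] avoids them all,
    and appending [g] gives a regular sequence of length [LF(G) + 1].  Hence
    Koenig type implies coverable ([konig_cover]).

    Conversely let [(F, S)] be a cover.  Modulo [P_S(F)] the [x_i] with [i] not
    in [S], together with one [y_i] for each component of [F \ S], are
    algebraically independent, and counting edges shows that there are
    [2n - LF(G)] of them.  A regular sequence inside [P_S(F)] is then
    algebraically independent together with these variables, because a relation
    can be divided repeatedly by the elements of the sequence; comparing the
    growth of spaces of polynomials of bounded degree, the length is at most
    [LF(G)] ([regular_sequence_size_le], [cover_bound]).

    Independence of the forest is a count ([cutset_transfer]).  If [(F, S)] is a
    cover, the components of [F' \ S] refine those of [F \ S].  Vertices of [S]
    meet at most [2|S|] edges of [F'], with equality only for cutsets; as [F]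
    and [F'] have equally many edges, [F' \ S] has at least as many edges as
    [F \ S], so it has no more components, and all comparisons are
    equalities. *)

(** * Forests laid out on a line *)

(** A linear forest is stored as an injective numbering [pos] of the vertices
    in which every edge joins consecutive numbers, together with the list [L]
    of its edges, oriented upwards.  Each vertex then has at most one edge to
    the left and one to the right, and subforests are sublists. *)
Section Layout.
Variables (V : finType) (pos : V -> nat).
Hypothesis pos_inj : injective pos.
Implicit Types (L : seq (V * V)) (S : {set V}).

Definition steps L := forall u v, (u, v) \in L -> pos v = (pos u).+1.

Definition link L : rel V := [rel u v | ((u, v) \in L) || ((v, u) \in L)].

Definition avoiding L S := [seq p <- L | (p.1 \notin S) && (p.2 \notin S)].

(** Independent sets of inner vertices: the sets [S] for which the kernels
    considered below are minimal over the ideal of the forest. *)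
Definition cutset L S :=
  [/\ forall v, v \in S -> exists u, (u, v) \in L,
      forall v, v \in S -> exists w, (v, w) \in L
    & forall u v, (u, v) \in L -> u \in S -> v \notin S].

Definition cutsetb L S := [&& [forall v in S, [exists u, (u, v) \in L]],
  [forall v in S, [exists w, (v, w) \in L]] &
  all (fun p => (p.1 \in S) ==> (p.2 \notin S)) L].

Lemma cutsetbP L S : reflect (cutset L S) (cutsetb L S).
Proof.
apply: (iffP and3P) => [[/forall_inP hl /forall_inP hr /allP ind]|[hl hr ind]]; split.
- by move=> v /hl/existsP.
- by move=> v /hr/existsP.
- by move=> u v /ind/implyP.
- by apply/forall_inP => v /hl/existsP.
- by apply/forall_inP => v /hr/existsP.
by apply/allP => -[u v] /ind/implyP.
Qed.

(** Every component contains exactly one such vertex, which makes counting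
    components the same as counting the edges. *)
Definition leftmost L := [set v | v \notin unzip2 L].

Lemma connect_invariant (e : rel V) (A : pred V) :
  (forall x y, e x y -> A x -> A y) ->
  forall x y, connect e x y -> A x -> A y.
Proof.
move=> eA x y /connectP[p + ->]; elim: p x => //= z p IH x /andP[exz pz] Ax.
exact: IH pz (eA _ _ exz Ax).
Qed.

Lemma link_sym L : connect_sym (link L).
Proof. by apply: sym_connect_sym => u v; rewrite /link /= orbC. Qed.

Lemma steps_sub L L' : {subset L' <= L} -> steps L -> steps L'.
Proof. by move=> sub sL u v /sub /sL. Qed.

Lemma avoidingP L S u v :
  ((u, v) \in avoiding L S) = [&& (u, v) \in L, u \notin S & v \notin S].
Proof. by rewrite mem_filter /= andbC. Qed.

Lemma steps_avoiding L S : steps L -> steps (avoiding L S).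
Proof. by apply: steps_sub => p; rewrite mem_filter => /andP[]. Qed.

Lemma uniq_unzip2 L : uniq L -> steps L -> uniq (unzip2 L).
Proof.
move=> uL sL; rewrite map_inj_in_uniq // => -[u v] [u' v'] /= p p' vv'.
rewrite -vv' in p' *; have := sL _ _ p; rewrite (sL _ _ p') => -[].
by move/pos_inj->.
Qed.

Lemma uniq_unzip1 L : uniq L -> steps L -> uniq (unzip1 L).
Proof.
move=> uL sL; rewrite map_inj_in_uniq // => -[u v] [u' v'] /= p p' uu'.
rewrite -uu' in p' *; have := sL _ _ p; rewrite -(sL _ _ p').
by move/pos_inj->.
Qed.

(** An edge is determined by its right endpoint. *)
Lemma card_leftmost L : uniq L -> steps L -> #|leftmost L| + size L = #|V|.
Proof.
move=> uL sL; rewrite -(cardC (mem (unzip2 L))) addnC; congr (_ + _); last first.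
  by apply: eq_card => v; rewrite !inE.
by rewrite (card_uniqP (uniq_unzip2 uL sL)) size_map.
Qed.

(** Numbers at least [pos i] are closed under links, since the only link that
    leaves them would be one from [i] to its left. *)
Lemma leftmost_connect_le L i j : steps L ->
  i \in leftmost L -> connect (link L) i j -> pos i <= pos j.
Proof.
rewrite inE => sL iL ij.
apply: (connect_invariant (A := fun v => pos i <= pos v)) ij _ => //.
move=> v w /orP[/sL ->|vw]; first by move/leq_trans; apply.
rewrite (sL _ _ vw) leq_eqVlt => /orP[/eqP|//].
rewrite -(sL _ _ vw) => /pos_inj iv; case/negP: iL; rewrite iv.
by apply/mapP; exists (w, v).
Qed.

Lemma leftmost_connect_eq L i j : steps L ->
  i \in leftmost L -> j \in leftmost L -> connect (link L) i j -> i = j.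
Proof.
move=> sL iL jL ij; apply/pos_inj/eqP; rewrite eqn_leq.
by rewrite !(leftmost_connect_le sL) // link_sym.
Qed.

(** Walk to the left until no edge continues. *)
Lemma leftmost_exists L v : steps L ->
  exists2 i, i \in leftmost L & connect (link L) i v.
Proof.
move=> sL; have [m] := ubnP (pos v); elim: m v => // m IH v.
rewrite ltnS => vm; have [/mapP[[u w] /= uv vw]|vL] := boolP (v \in unzip2 L).
  rewrite -vw in uv; have [|i iL iu] := IH u; first by rewrite (sL _ _ uv) in vm.
  by exists i => //; apply: connect_trans iu (connect1 _); rewrite /link /= uv.
by exists v; rewrite // inE.
Qed.

Section EdgeCount.
Variables (L : seq (V * V)) (S : {set V}).
Hypotheses (uL : uniq L) (sL : steps L).

Let into := [seq p <- L | p.2 \in S].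
Let outof := [seq p <- L | p.1 \in S].

Let into_sub : {subset unzip2 into <= enum S}.
Proof. by move=> v /mapP[[u w]]; rewrite mem_filter mem_enum => /andP[] ? _ ->. Qed.

Let outof_sub : {subset unzip1 outof <= enum S}.
Proof. by move=> v /mapP[[u w]]; rewrite mem_filter mem_enum => /andP[] ? _ ->. Qed.

Let into_uniq : uniq (unzip2 into).
Proof.
apply: (uniq_unzip2 (filter_uniq _ uL)).
by apply: steps_sub sL => p; rewrite mem_filter => /andP[].
Qed.

Let outof_uniq : uniq (unzip1 outof).
Proof.
apply: (uniq_unzip1 (filter_uniq _ uL)).
by apply: steps_sub sL => p; rewrite mem_filter => /andP[].
Qed.

Let inner := [pred p : V * V | (p.1 \in S) && (p.2 \in S)].

(* Inclusion-exclusion on the edges that meet S. *)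
Let size_split :
  size L + count inner L = size (avoiding L S) + (size into + size outof).
Proof.
rewrite /avoiding /into /outof !size_filter.
rewrite -(count_predC (fun p : V * V => (p.1 \notin S) && (p.2 \notin S)) L) -addnA.
congr (_ + _); rewrite addnC [RHS]addnC -[RHS]count_predUI addnC.
by congr (_ + _); apply: eq_count => p /=; rewrite negb_and !negbK.
Qed.

(** Each vertex of [S] meets at most one edge on either side. *)
Lemma size_avoiding_ge : size L <= size (avoiding L S) + #|S|.*2.
Proof.
apply: (@leq_trans (size L + count inner L)); first exact: leq_addr.
rewrite size_split leq_add2l -addnn leq_add //.
  by rewrite -(size_map snd) cardE uniq_leq_size.
by rewrite -(size_map fst) cardE uniq_leq_size.
Qed.

Lemma cutset_size : cutset L S -> size L = size (avoiding L S) + #|S|.*2.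
Proof.
case=> hl hr ind; have := size_split.
have -> : count inner L = 0.
  apply/eqP; rewrite -leqn0 leqNgt -has_count; apply/hasPn => -[u v] uv /=.
  by apply/negP => /andP[/(ind _ _ uv) /negP].
rewrite addn0 => ->; rewrite -addnn; congr (_ + (_ + _)).
  rewrite -(size_map snd) cardE; apply/perm_size/uniq_perm => //.
    exact: enum_uniq.
  move=> v; apply/idP/idP; first exact: into_sub.
  rewrite mem_enum => vS; have [u uv] := hl v vS.
  by apply/mapP; exists (u, v); rewrite // mem_filter /= vS.
rewrite -(size_map fst) cardE; apply/perm_size/uniq_perm => //.
  exact: enum_uniq.
move=> v; apply/idP/idP; first exact: outof_sub.
rewrite mem_enum => vS; have [u uv] := hr v vS.
by apply/mapP; exists (v, u); rewrite // mem_filter /= vS.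
Qed.

(** The extremal case of the bound: each vertex of [S] has both its edges and no
    edge is counted from both ends. *)
Lemma size_cutset : size (avoiding L S) + #|S|.*2 <= size L -> cutset L S.
Proof.
move=> le; have := leq_add le (leqnn (count inner L)).
rewrite size_split -addnA leq_add2l -addnn => {}le.
have le1 : size into <= #|S|.
  by rewrite -(size_map snd) cardE uniq_leq_size.
have le2 : size outof <= #|S|.
  by rewrite -(size_map fst) cardE uniq_leq_size.
have c0 : count inner L = 0.
  apply/eqP; rewrite -leqn0 -(leq_add2l (#|S| + #|S|)) addn0.
  exact: leq_trans le (leq_add le1 le2).
rewrite c0 addn0 in le.
have ge1 : #|S| <= size into.
  by rewrite -(leq_add2r #|S|) (leq_trans le) // leq_add2l.
have ge2 : #|S| <= size outof.
  by rewrite -(leq_add2l #|S|) (leq_trans le) // leq_add2r.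
have [|_ eq1] := uniq_min_size into_uniq into_sub; first by rewrite -cardE size_map.
have [|_ eq2] := uniq_min_size outof_uniq outof_sub; first by rewrite -cardE size_map.
split=> [v vS|v vS|u v uv uS].
- have : v \in enum S by rewrite mem_enum.
  rewrite -eq1 => /mapP[[u w] /=]; rewrite mem_filter => /andP[_ uw] ->.
  by exists u.
- have : v \in enum S by rewrite mem_enum.
  rewrite -eq2 => /mapP[[u w] /=]; rewrite mem_filter => /andP[_ uw] ->.
  by exists w.
apply/negP => vS; move/eqP: c0; rewrite -leqn0 leqNgt -has_count => /hasPn.
by move/(_ _ uv); rewrite /= uS vS.
Qed.

End EdgeCount.

(** * Standard exponents are determined by their sums over components *)

Section Runs.
Variables (L : seq (V * V)) (U : pred V).
Hypothesis sL : steps L.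

(** Given a set [U] of vertices, the support of a monomial, this picks the first
    vertex of every gap that follows a stretch of [U], unless the path ends
    there.  Removing these vertices separates the stretches of [U]. *)
Definition gaps := [set w | [&& ~~ U w,
  [exists u, U u && ((u, w) \in L)] & [exists x, (w, x) \in L]]].

Lemma cutset_gaps : cutset L gaps.
Proof.
split=> [v|v|u v uv].
- by rewrite inE => /and3P[_ /existsP[u /andP[_ uv]] _]; exists u.
- by rewrite inE => /and3P[_ _ /existsP[x vx]]; exists x.
rewrite !inE => /and3P[nUu _ _]; apply/and3P => -[_ /existsP[w /andP[Uw wv]] _].
have := sL wv; rewrite (sL uv) => -[/pos_inj uw].
by rewrite uw Uw in nUu.
Qed.

(** Inside a component left after removing the gaps, [U] is an unbroken
    stretch, so walking to the right from [i] the hypothesis on single edges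
    propagates.  For standard monomials, [P] and [Q] are the supports in the
    [x]'s and in the [y]'s: once an [x] occurs, no [y] occurs further right. *)
Lemma run_transport (P Q : pred V) i j :
    (forall v, U v = P v || Q v) ->
    (forall u v, (u, v) \in L -> P u -> ~~ Q v) ->
    connect (link (avoiding L gaps)) i j -> pos i < pos j -> P i -> ~~ Q j.
Proof.
move=> UE std ij lt_ij Pi.
(* A good vertex outside U is a dead end.  The statement quantifies over all
   vertices between i and v, so that steps to the left preserve it. *)
pose good v := ~~ Q v && (U v || [forall x, (v, x) \notin L]).
pose A v := [forall w, (pos i < pos w <= pos v) ==> good w].
suff /forallP/(_ j) : A j by rewrite lt_ij leqnn => /andP[].
apply: (connect_invariant (A := A)) ij _; last first.
  by apply/forallP => w; case: leqP => //= /ltn_geF ->.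
move=> v w /orP[]; rewrite avoidingP => /and3P[vw ni nj] /forallP Av.
  apply/forallP => x; apply/implyP => /andP[ix xw].
  have [xv|xv] := leqP (pos x) (pos v).
    by have := Av x; rewrite ix xv.
  have {xv xw}xw : x = w.
    by apply: pos_inj; apply/eqP; rewrite eqn_leq xw (sL vw).
  rewrite {}xw in ix *.
  have Pv : P v.
    move: ix; rewrite (sL vw) ltnS leq_eqVlt => /orP[/eqP/pos_inj<- //|iv].
    have /implyP := Av v; rewrite iv leqnn => /(_ isT) /andP[nQ /orP[|/forallP/(_ w)]].
      by rewrite UE (negPf nQ) orbF.
    by rewrite vw.
  rewrite /good (std _ _ vw Pv) /=.
  have [//|nUw /=] := boolP (U w); apply/forallP => y; apply: contra nj => wy.
  rewrite inE nUw /=; apply/andP; split; apply/existsP; last by exists y.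
  by exists v; rewrite UE Pv.
apply/forallP => x; apply/implyP => /andP[ix xw].
by have /implyP := Av x; apply; rewrite ix (sL vw) leqW.
Qed.

End Runs.

(** [a] and [b] are the exponents of the [x]'s and [y]'s of a monomial that no
    [x_u y_v], with [(u, v)] an edge, divides. *)
Definition standard L (a b : V -> nat) :=
  forall u v, (u, v) \in L -> 0 < a u -> b v = 0.

(** If [b i < b' i], then [a i > 0] forces [b] to vanish to the right of [i],
    and [b' i > 0] forces [a'] to vanish to the left of [i], so that [b'] is as
    large as possible there.  Hence [b <= b'] on the whole component of [i],
    strictly at [i], and the sums differ. *)
Lemma standard_inj L (a b a' b' : V -> nat) :
    let T := gaps L (fun v => 0 < a v + b v) in
    let comp v := fingraph.root (link (avoiding L T)) v in
    steps L -> standard L a b -> standard L a' b' ->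
    (forall v, a v + b v = a' v + b' v) ->
    (forall r, \sum_(v | comp v == r) b v = \sum_(v | comp v == r) b' v) ->
  b =1 b'.
Proof.
move=> T comp sL st st' ab sb.
have UE (x y : nat) : (0 < x + y) = (0 < x) || (0 < y) by rewrite addn_gt0.
wlog [i bi] : a b a' b' @T @comp st st' ab sb / exists i, b i < b' i.
  move=> IH i; case: (ltngtP (b i) (b' i)) => // lt.
    by apply: (IH a b a' b') => //; exists i.
  have TE : gaps L (fun v => 0 < a' v + b' v) = T.
    apply/setP => v; rewrite !inE ab; congr [&& _, _ & _].
    by apply: eq_existsb => u; rewrite ab.
  apply/esym/(IH a' b' a b) => //; last by exists i.
  by move=> r; rewrite TE sb.
have := sb (comp i); rewrite (bigD1 i) //= [RHS](bigD1 i) //= => /eqP.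
rewrite ltn_eqF // -addSn leq_add //; apply: leq_sum => v /andP[ci vi].
have {ci}ci : connect (link (avoiding L T)) v i.
  by rewrite -(root_connect (link_sym _)).
case: (ltngtP (pos v) (pos i)) => [lt|lt|/pos_inj vE]; last by rewrite vE eqxx in vi.
  have : a' v == 0.
    rewrite -leqn0 leqNgt; apply/negP => a'v.
    suff : ~~ (0 < b' i) by rewrite (leq_ltn_trans (leq0n _) bi).
    apply: (run_transport (P := fun v => 0 < a' v) (Q := fun v => 0 < b' v)
      sL _ _ ci lt a'v) => [u|u w uw /(st' _ _ uw) -> //].
    by rewrite /= ab UE.
  by move/eqP=> a'v; have := ab v; rewrite a'v add0n => <-; apply: leq_addl.
have : ~~ (0 < b v).
  rewrite link_sym in ci.
  apply: (run_transport (P := fun v => 0 < a v) (Q := fun v => 0 < b v) sL _ _ ci lt) => //.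
    by move=> u w uw /(st _ _ uw) ->.
  by rewrite -(ltn_add2r (b i)) add0n ab (leq_trans bi) ?leq_addl.
by rewrite -leqNgt leqn0 => /eqP->.
Qed.

End Layout.

(** * Comparing two forests of the same size *)

Section Transfer.
Variables (V : finType) (pos pos' : V -> nat).
Hypotheses (pos_inj : injective pos) (pos_inj' : injective pos').
Variables (L L' : seq (V * V)) (S : {set V}).
Hypotheses (uL : uniq L) (sL : steps pos L).
Hypotheses (uL' : uniq L') (sL' : steps pos' L').

(** Sending a leftmost vertex for [L'] to its component for [L] is onto.  The
    first forest supplies at least as many components as the second, so
    this map is injective: the two partitions into components agree. *)
Lemma cutset_transfer :
    cutset L S -> size L = size L' ->
    (forall u v, (u, v) \in avoiding L' S -> connect (link (avoiding L S)) u v) ->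
  cutset L' S /\ forall i j, connect (link (avoiding L S)) i j ->
                             connect (link (avoiding L' S)) i j.
Proof.
move=> cutS szL sub.
set M := avoiding L S in sub *; set M' := avoiding L' S in sub *.
have uM : uniq M by apply: filter_uniq.
have uM' : uniq M' by apply: filter_uniq.
have sM : steps pos M by apply: steps_avoiding.
have sM' : steps pos' M' by apply: steps_avoiding.
have le_size : size M <= size M'.
  rewrite -(leq_add2r #|S|.*2) -(cutset_size pos_inj uL sL cutS) szL.
  exact: (size_avoiding_ge pos_inj').
have subc i j : connect (link M') i j -> connect (link M) i j.
  apply: connect_sub => u v /orP[/sub //|/sub].
  by rewrite link_sym.
pose rt := fingraph.root (link M).
have rtP i j : (rt i == rt j) = connect (link M) i j.
  exact: root_connect (link_sym _) _ _.
have rt_inj : {in leftmost M &, injective rt}.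
  by move=> i j iM jM /eqP; rewrite rtP => /(leftmost_connect_eq pos_inj sM); apply.
have rt_sub : rt @: leftmost M \subset rt @: leftmost M'.
  apply/subsetP => _ /imsetP[i iM ->].
  have [i' iM' ii'] := leftmost_exists i sM'; apply/imsetP; exists i' => //.
  by apply/eqP; rewrite rtP link_sym subc.
have card_le : #|leftmost M'| <= #|leftmost M|.
  rewrite -(leq_add2r (size M')) (card_leftmost pos_inj' uM' sM').
  by rewrite -(card_leftmost pos_inj uM sM) leq_add2l.
have card_eq : #|rt @: leftmost M'| == #|leftmost M'|.
  rewrite eqn_leq leq_imset_card (leq_trans card_le) //.
  by rewrite -(card_in_imset rt_inj) subset_leq_card.
have/imset_injP rt_inj' := card_eq.
split.
  apply: (size_cutset pos_inj') => //.
  rewrite -szL (cutset_size pos_inj uL sL cutS) leq_add2r.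
  rewrite -(leq_add2l #|leftmost M'|) (card_leftmost pos_inj' uM' sM').
  rewrite -(card_leftmost pos_inj uM sM) leq_add2r.
  by rewrite -(card_in_imset rt_inj) -(eqP card_eq) subset_leq_card.
move=> i j ij.
have [i' iM' ii'] := leftmost_exists i sM'.
have [j' jM' jj'] := leftmost_exists j sM'.
suff eq_ij : i' = j'.
  by apply: connect_trans jj'; rewrite -eq_ij link_sym.
apply: rt_inj' => //; apply/eqP; rewrite rtP.
apply: connect_trans (subc _ _ ii') (connect_trans ij _).
by rewrite link_sym subc.
Qed.

End Transfer.

(** * Linear forests as graphs *)

Section Graphs.
Variable T : finType.
Implicit Types (F G : graph T) (S : {set T}).

Lemma edge_card F e : e \in edges F -> #|e| = 2.
Proof. by have /forall_inP h := valP F => /h /andP[/eqP]. Qed.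

Lemma edge_verts F e : e \in edges F -> e \subset verts F.
Proof. by have /forall_inP h := valP F => /h /andP[]. Qed.

Lemma adj_sym F u v : adj F u v = adj F v u.
Proof. by rewrite /adj /= setUC. Qed.

Lemma adj_irr F u : adj F u u = false.
Proof. by apply/negP => /edge_card; rewrite setUid cards1. Qed.

Lemma adj_verts F u v : adj F u v -> (u \in verts F) && (v \in verts F).
Proof. by move=> /edge_verts; rewrite subUset !sub1set. Qed.

Lemma adj_delete F S u v :
  adj (delete F S) u v = [&& adj F u v, u \notin S & v \notin S].
Proof. by rewrite /adj /= inE subUset !sub1set !inE. Qed.

Lemma adj_connect_sym F : connect_sym (adj F).
Proof. by apply: sym_connect_sym => u v; apply: adj_sym. Qed.

Lemma zip_behead_index (t : seq T) u v :
  uniq t -> (u, v) \in zip t (behead t) -> index v t = (index u t).+1.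
Proof.
move=> ut /(nthP (u, u))[i]; rewrite size_zip size_behead => lt_i.
rewrite nth_zip_cond size_zip size_behead lt_i nth_behead => -[<- <-].
have {}lt_i : i.+1 < size t by case: (t) lt_i => //= x s; rewrite ltnS leq_min => /andP[].
by rewrite !index_uniq // ltnW.
Qed.

Lemma path_index F : is_path F ->
  exists t : seq T, [/\ size t = #|verts F|, {subset verts F <= t}
    & forall u v, adj F u v ->
      index v t = (index u t).+1 \/ index u t = (index v t).+1].
Proof.
case/andP => _ /existsP[t /and3P[ut /eqP tV /eqP tE]]; exists t.
split=> [|v|u v]; first exact: size_tuple.
  by move/setP/(_ v): tV; rewrite inE => <-.
move=> uv; have nuv : u != v by apply/negP => /eqP uE; rewrite uE adj_irr in uv.
move: uv; rewrite /adj /= tE => /imsetP[[a b] ab /= uv].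
have idx := zip_behead_index ut ab.
have : u \in [set a; b] by rewrite -uv !inE eqxx.
have : v \in [set a; b] by rewrite -uv !inE eqxx orbT.
rewrite !inE => /orP[]/eqP vE /orP[]/eqP uE; rewrite uE vE ?eqxx // in nuv *.
- by right.
- by left.
Qed.

Lemma connect_verts F x y : connect (adj F) x y -> x \in verts F -> y \in verts F.
Proof.
have inv u v : adj F u v -> u \in verts F -> v \in verts F.
  by move=> /adj_verts /andP[].
exact: (connect_invariant inv).
Qed.

(** Number the vertices block by block, one block for each component, and within
    a block by the position in the path.  Blocks are given length [#|T| + 1], so
    that the number determines block and position. *)
Lemma linear_forest_pos F : linear_forest F ->
  exists2 pos : T -> nat, injective pos
    & forall u v, adj F u v -> pos v = (pos u).+1 \/ pos u = (pos v).+1.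
Proof.
move=> /forall_inP lf.
have [t tP] : exists t : T -> seq T, forall r, r \in verts F ->
  [/\ size (t r) <= #|T|, forall y, connect (adj F) r y -> y \in t r
    & forall u v, connect (adj F) r u -> adj F u v ->
      index v (t r) = (index u (t r)).+1 \/ index u (t r) = (index v (t r)).+1].
  suff h r : exists s : seq T, r \in verts F ->
    [/\ size s <= #|T|, forall y, connect (adj F) r y -> y \in s
      & forall u v, connect (adj F) r u -> adj F u v ->
        index v s = (index u s).+1 \/ index u s = (index v s).+1].
    by have [t tP] := fin_all_exists h; exists t.
  have [rF|_] := boolP (r \in verts F); last by exists [::].
  have [s [szs ss adjs]] := path_index (lf r rF); exists s => _; split.
  - by rewrite szs max_card.
  - move=> y ry; apply: ss; rewrite inE.
    have yF := connect_verts ry rF.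
    by rewrite yF inE /same_component rF yF.
  move=> u v ru uv; apply: adjs.
  have vF := connect_verts ru rF.
  have rv := connect_trans ru (connect1 uv).
  have wF := connect_verts rv rF.
  rewrite /adj /= inE -[_ \in edges F]/(adj F u v) uv /=.
  by rewrite subUset !sub1set !inE /same_component rF vF wF ru.
pose rt := fingraph.root (adj F).
have symF := adj_connect_sym F.
have rtv v : connect (adj F) (rt v) v by rewrite symF connect_root.
have rtF v : v \in verts F -> rt v \in verts F.
  by apply: connect_verts; apply: connect_root.
(* A vertex outside F is alone in its component and gets the first position. *)
pose idx v := if v \in verts F then index v (t (rt v)) else 0.
have idx_lt v : idx v < #|T|.+1.
  rewrite /idx; case: ifP => // vF; have [sz _ _] := tP _ (rtF _ vF).
  by rewrite ltnS (leq_trans _ sz) // index_size.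
exists (fun v => enum_rank (rt v) * #|T|.+1 + idx v) => [u v|u v uv].
  move=> uv.
  have idx_uv : idx u = idx v.
    by have := congr1 (modn^~ #|T|.+1) uv; rewrite !modnMDl !modn_small.
  have /enum_rank_inj rt_uv : enum_rank (rt u) = enum_rank (rt v).
    apply: val_inj => /=; have := congr1 (divn^~ #|T|.+1) uv.
    by rewrite !divnMDl // !divn_small // !addn0.
  have cuv : connect (adj F) u v by rewrite -(root_connect symF); apply/eqP.
  have vu : (v \in verts F) = (u \in verts F).
    by apply/idP/idP; apply: connect_verts; rewrite // symF.
  move: idx_uv; rewrite /idx vu; case: ifP => uF.
    rewrite rt_uv => idx_uv; rewrite uF in vu; have [_ sub _] := tP _ (rtF _ vu).
    rewrite -[u](nth_index u (sub u _)); last by rewrite -rt_uv.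
    by rewrite idx_uv nth_index // sub.
  move=> _; case/connectP: cuv => -[|w p] /= => [_ -> //|/andP[/adj_verts]].
  by rewrite uF.
have /andP[uF vF] := adj_verts uv.
have rt_uv : rt u = rt v.
  by apply/eqP; rewrite (root_connect symF) connect1.
have [_ _ /(_ u v (rtv u) uv)] := tP _ (rtF _ uF).
by rewrite /idx uF vF rt_uv -!addnS => -[->|->]; [left|right].
Qed.

Definition layout F (pos : T -> nat) L :=
  [/\ injective pos, uniq L, steps pos L, adj F =2 link L & #|edges F| = size L].

Lemma linear_forest_layout F : linear_forest F ->
  exists pos L, layout F pos L.
Proof.
case/linear_forest_pos => pos pos_inj posF; exists pos.
pose E := [pred p : T * T | adj F p.1 p.2 && (pos p.2 == (pos p.1).+1)].
exists (enum E).
have memE u v : ((u, v) \in enum E) = adj F u v && (pos v == (pos u).+1).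
  by rewrite mem_enum.
have inj : {in E &, injective (fun p : T * T => [set p.1; p.2])}.
  move=> [a b] [c d] /=; rewrite !inE /= => /andP[_ /eqP ab] /andP[_ /eqP cd] eq.
  have : a \in [set c; d] by rewrite -eq !inE eqxx.
  have : b \in [set c; d] by rewrite -eq !inE eqxx orbT.
  have lt_ab : pos a < pos b by rewrite ab.
  have lt_cd : pos c < pos d by rewrite cd.
  rewrite !inE => /orP[]/eqP bE /orP[]/eqP aE; rewrite aE bE ?ltnn // in lt_ab *.
  by have := ltn_trans lt_ab lt_cd; rewrite ltnn.
split=> //.
- exact: enum_uniq.
- by move=> u v; rewrite memE => /andP[_ /eqP].
- move=> u v; rewrite /link /= !memE (adj_sym F v u) -andb_orr.
  by case: (boolP (adj F u v)) => //= /posF[]->; rewrite eqxx ?orbT.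
rewrite -cardE -(card_in_imset inj); apply: eq_card => e.
apply/idP/imsetP; [move=> eF|by case=> -[u v] /andP[uv _] ->].
have /cards2P[u [v [nuv eE]]] := introT eqP (edge_card eF).
have uv : adj F u v by rewrite /adj /= -eE.
have [pE|pE] := posF _ _ uv; [exists (u, v)|exists (v, u)] => //=.
- by rewrite inE /= uv pE eqxx.
- by rewrite inE /= adj_sym uv pE eqxx.
by rewrite setUC.
Qed.

Section LayoutFacts.
Variables (F : graph T) (pos : T -> nat) (L : seq (T * T)).
Hypothesis lay : layout F pos L.

Lemma adj_delete_link S : adj (delete F S) =2 link (avoiding L S).
Proof.
case: lay => _ _ _ FL _ u v.
rewrite adj_delete FL /link /= !avoidingP.
by case: (u \in S); case: (v \in S); rewrite /= ?andbF ?andbT.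
Qed.

Lemma connect_delete_link S :
  connect (adj (delete F S)) =2 connect (link (avoiding L S)).
Proof. exact: eq_connect (adj_delete_link S). Qed.

Lemma degree_gt1 v :
  reflect ((exists u, (u, v) \in L) /\ exists w, (v, w) \in L) (1 < degree F v).
Proof.
case: lay => pos_inj _ sL FL _; rewrite /degree.
have nbE w : (w \in [set w | adj F v w]) = ((v, w) \in L) || ((w, v) \in L).
  by rewrite inE FL.
apply: (iffP card_gt1P) => [[a [b [+ + ab]]]|[[u uv] [w vw]]]; last first.
  exists u, w; rewrite !nbE uv vw orbT; split=> //.
  by apply/eqP => uw; have := sL _ _ uv; rewrite uw (sL _ _ vw) => /eqP;
     rewrite -addn2 -{1}[pos v]addn0 eqn_add2l.
rewrite !nbE => /orP[va|av] /orP[vb|bv].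
- by case/eqP: ab; apply: pos_inj; rewrite (sL _ _ va) (sL _ _ vb).
- by split; [exists b|exists a].
- by split; [exists a|exists b].
- case/eqP: ab; apply: pos_inj; apply/eqP.
  by rewrite -eqSS -(sL _ _ av) (sL _ _ bv).
Qed.

Lemma cutset_verts S : cutset L S -> S \subset verts F.
Proof.
case: lay => _ _ _ FL _ [hl _ _]; apply/subsetP => v /hl[u uv].
have : adj F u v by rewrite FL /link /= uv.
by case/adj_verts/andP.
Qed.

(** This identifies cutsets with the sets allowed by conditions (1) and (2) of
    an LF-cover. *)
Lemma cutsetP S :
  cutset L S <-> [/\ S \subset verts F, forall v, v \in S -> ~~ leaf F v
    & forall u v, u \in S -> v \in S -> ~~ adj F u v].
Proof.
case: (lay) => _ _ _ FL _; split=> [cS|[SF nleaf ind]].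
  split=> [|v vS|u v uS vS]; first exact: cutset_verts.
    rewrite /leaf negb_and -ltnNge; apply/orP; right; apply/degree_gt1.
    by case: cS => hl hr _; split; [apply: hl|apply: hr].
  case: cS => _ _ ind; rewrite FL; apply/negP => /orP[uv|vu].
    by have := ind _ _ uv uS; rewrite vS.
  by have := ind _ _ vu vS; rewrite uS.
have two v : v \in S -> 1 < degree F v.
  by move=> vS; have := nleaf v vS; rewrite /leaf (subsetP SF) //= -ltnNge.
split=> [v /two/degree_gt1[]|v /two/degree_gt1[]|u v uv uS] //.
by apply/negP => vS; have := ind _ _ uS vS; rewrite FL /link /= uv.
Qed.

Lemma LF_cover_layout G S : LF_cover G F S <->
  [/\ maximal_linear_forest G F, cutset L S
    & forall i j, adj G i j -> [\/ i \in S, j \in S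
                                | connect (link (avoiding L S)) i j]].
Proof.
split=> [[mF SF nl ind cov]|[mF /cutsetP[SF nl ind] cov]].
  split=> // [|i j ij]; first exact/cutsetP.
  case: (cov i j ij) => [| |/and3P[_ _]]; [by constructor 1|by constructor 2|].
  by rewrite connect_delete_link; constructor 3.
split=> // i j ij; case: (cov i j ij) => [| |c]; [by constructor 1|by constructor 2|].
have nij : i != j by apply/eqP => iE; rewrite iE adj_irr in ij.
constructor 3; rewrite /same_component connect_delete_link c andbT.
(* Connected distinct vertices are endpoints of edges, hence vertices of the
   forest even when it does not span. *)
have endv u v : u != v -> connect (link (avoiding L S)) u v ->
    u \in verts (delete F S).
  move=> nuv; rewrite -connect_delete_link => /connectP[[|w p] /=].
    by move=> _ vu; rewrite vu eqxx in nuv.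
  by case/andP => /adj_verts/andP[].
by rewrite (endv _ _ nij c) (endv j i) // 1?eq_sym // link_sym.
Qed.

End LayoutFacts.

Lemma ex_maximal_linear_forest G :
  exists2 F, maximal_linear_forest G F & LF G = #|edges F|.
Proof.
have ax : graph_axiom (set0 : {set T}, set0 : {set {set T}}).
  by apply/forall_inP => e; rewrite inE.
have lf0 : linear_forest_in G (Graph ax).
  rewrite /linear_forest_in /subgraph !sub0set /=.
  by apply/forall_inP => x; rewrite inE.
have : 0 < #|[pred F | linear_forest_in G F]|.
  by apply/card_gt0P; exists (Graph ax).
case/(eq_bigmax_cond (fun F => #|edges F|)) => F lfF LFE.
exists F => //; split=> // F' lfF'.
by rewrite -LFE; apply: leq_bigmax_cond.
Qed.

Lemma maximal_LF G F : maximal_linear_forest G F -> LF G = #|edges F|.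
Proof.
case=> lfF maxF; have [F' [lfF' maxF'] ->] := ex_maximal_linear_forest G.
by apply/eqP; rewrite eqn_leq maxF ?maxF'.
Qed.

Lemma LF_cover_transfer G F F' S :
  maximal_linear_forest G F -> maximal_linear_forest G F' ->
  LF_cover G F S -> LF_cover G F' S.
Proof.
move=> mF mF'.
have [/andP[_ lfF] _] := mF; have [/andP[/andP[_ sub'] lfF'] _] := mF'.
have [pos [L lay]] := linear_forest_layout lfF.
have [pos' [L' lay']] := linear_forest_layout lfF'.
case/(LF_cover_layout lay) => _ cS cov; apply/(LF_cover_layout lay').
case: (lay) => pos_inj uL sL FL szL; case: (lay') => pos_inj' uL' sL' FL' szL'.
have [||cS' sub] := cutset_transfer pos_inj pos_inj' uL sL uL' sL' cS.
- by rewrite -szL -szL' -(maximal_LF mF) (maximal_LF mF').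
- move=> u v; rewrite avoidingP => /and3P[uv uS vS].
  have uvG : adj G u v.
    by apply: (subsetP sub'); rewrite -[_ \in _]/(adj F' u v) FL' /link /= uv.
  by case: (cov _ _ uvG) => // [uS'|vS']; [rewrite uS' in uS|rewrite vS' in vS].
split=> // i j /cov[iS|jS|/sub c]; [by constructor 1|by constructor 2|by constructor 3].
Qed.

End Graphs.

(** * Ideals given by generators *)

Section Ideals.
Local Open Scope ring_scope.
Variable R : comNzRingType.
Implicit Types (A B : R -> Prop) (f g : R) (s : seq R).

Lemma ideal_gen0 A : ideal_gen A 0.
Proof. by exists [::]; rewrite big_nil. Qed.

Lemma ideal_genD A f g : ideal_gen A f -> ideal_gen A g -> ideal_gen A (f + g).
Proof.
case=> s [sA ->] [t [tA ->]]; exists (s ++ t); rewrite big_cat; split=> // p.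
by rewrite mem_cat => /orP[/sA|/tA].
Qed.

Lemma ideal_genM A f g : ideal_gen A g -> ideal_gen A (f * g).
Proof.
case=> s [sA ->]; exists [seq (f * p.1, p.2) | p <- s]; split.
  by move=> _ /mapP[q /sA qA ->].
by rewrite big_map big_distrr /=; apply: eq_bigr => p _; rewrite mulrA.
Qed.

Lemma ideal_genB A f g : ideal_gen A f -> ideal_gen A g -> ideal_gen A (f - g).
Proof. by move=> Af Ag; rewrite -mulN1r; apply/ideal_genD/ideal_genM. Qed.

Lemma ideal_gen_mem A f : A f -> ideal_gen A f.
Proof.
move=> Af; exists [:: (1, f)]; rewrite big_seq1 mul1r; split=> // p.
by rewrite inE => /eqP->.
Qed.

Lemma ideal_gen_sum A (I : Type) (r : seq I) (P : pred I) (F : I -> R) :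
  (forall i, P i -> ideal_gen A (F i)) -> ideal_gen A (\sum_(i <- r | P i) F i).
Proof.
by move=> AF; elim/big_ind: _ => //; [apply: ideal_gen0|apply: ideal_genD].
Qed.

Lemma ideal_gen_sub A B f :
  (forall g, A g -> ideal_gen B g) -> ideal_gen A f -> ideal_gen B f.
Proof.
move=> AB [s [sA ->]]; rewrite big_seq_cond; apply: ideal_gen_sum => p.
by rewrite andbT => /sA/AB/ideal_genM.
Qed.

Lemma ideal_gen_ker (S : comNzRingType) (phi : {rmorphism R -> S}) A f :
  (forall g, A g -> phi g = 0) -> ideal_gen A f -> phi f = 0.
Proof.
move=> kerA [s [sA ->]]; rewrite rmorph_sum big_seq big1 //= => p /sA/kerA p0.
by rewrite rmorphM p0 mulr0.
Qed.

End Ideals.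

(** * The length of regular sequences *)

Section Growth.
Local Open Scope ring_scope.
Variables (k : fieldType) (N : nat).
Local Notation R := {mpoly k[N]}.
Implicit Types (I : R -> Prop) (s : seq R).

(** Linear independence over [k] modulo [I]. *)
Definition independent I (J : finType) (B : J -> R) :=
  forall c : J -> k, I (\sum_j c j *: B j) -> forall j, c j = 0.

(** If [f] is a nonzerodivisor modulo [I] and [I'] is [I + (f)], the part of a
    relation without [f] vanishes modulo [I'], hence has zero coefficients; what
    remains can be divided by [f]. *)
Lemma independent_powers I I' (f : R) (J : finType) (B : J -> R) M :
    (forall p q, I (p + f * q) -> I' p) -> (forall q, I (f * q) -> I q) ->
    independent I' B ->
  independent I (fun j : 'I_M * J => f ^+ j.1 * B j.2).
Proof.
move=> II' regf indB c.
have -> : \sum_j c j *: (f ^+ j.1 * B j.2)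
        = \sum_(i < M) f ^+ i * \sum_j c (i, j) *: B j.
  rewrite (eq_bigr (fun i : 'I_M => \sum_j c (i, j) *: (f ^+ i * B j))).
    by rewrite pair_bigA /=; apply: eq_bigr => -[i j].
  by move=> i _; rewrite big_distrr /=; apply: eq_bigr => j _; rewrite scalerAr.
move=> Ic [i j] /=; elim: M c Ic i j => [|M IH] c; first by move=> _ [].
rewrite big_ord_recl expr0 mul1r.
have -> : \sum_(i < M) f ^+ lift ord0 i * (\sum_j c (lift ord0 i, j) *: B j)
        = f * \sum_(i < M) f ^+ i * (\sum_j c (lift ord0 i, j) *: B j).
  by rewrite big_distrr /=; apply: eq_bigr => i _; rewrite exprS mulrA.
move=> Ic; have c0 := indB _ (II' _ _ Ic); move: Ic.
rewrite big1 ?add0r => [/regf Ic i j|j _]; last by rewrite c0 scale0r.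
have [i' ->|->] := unliftP ord0 i; last exact: c0.
exact: (IH (fun p => c (lift ord0 p.1, p.2))).
Qed.

Lemma msize_exp (f : R) i : (msize (f ^+ i) <= i * (msize f).+1 + 1)%N.
Proof.
elim: i => [|i IH]; first by rewrite expr0 msize1.
rewrite exprS (leq_trans (msizeM_le _ _)) // mulSn -addnA -addSn addSnnS.
by rewrite addSn -addnS leq_add // leqW.
Qed.

Lemma independent_monomials I (W : {set 'I_N}) M :
    (forall p : R, (forall m, m \in msupp p -> forall v, v \notin W -> m v = 0%N) ->
      I p -> p = 0) ->
  exists (J : finType) (B : J -> R),
    [/\ independent I B, #|J| = (M ^ #|W|)%N &
        forall j, (msize (B j) <= N * M + 1)%N].
Proof.
move=> WI.
pose mon (w : {ffun {v | v \in W} -> 'I_M}) : 'X_{1..N} :=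
  [multinom (if insub v is Some u then w u : nat else 0%N) | v < N].
have mon_inj : injective mon.
  move=> w w' /mnmP ww'; apply/ffunP => u; apply/val_inj => /=.
  by have := ww' (val u); rewrite !mnmE valK.
exists {ffun {v | v \in W} -> 'I_M}, (fun w => 'X_[mon w]); split=> [c Ic w||w].
- have p0 : \sum_w c w *: 'X_[mon w] = 0 :> R.
    apply: WI Ic => m /msupp_sum_le /flatten_mapP[w' _ /msuppZ_le].
    rewrite msuppX inE => /eqP -> v vW.
    by rewrite mnmE insubN.
  have := congr1 (mcoeff (mon w)) p0; rewrite mcoeff0 raddf_sum (bigD1 w) //=.
  rewrite mcoeffZ mcoeffX eqxx mulr1 big1 ?addr0 // => w' w'w.
  by rewrite mcoeffZ mcoeffX (inj_eq mon_inj) (negPf w'w) mulr0.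
- by rewrite card_ffun card_ord card_sig; congr (_ ^ _)%N; apply: eq_card => v.
rewrite msizeX addn1 ltnS mdegE -[X in (X * _)%N]card_ord -sum_nat_const.
by apply: leq_sum => v _; rewrite mnmE; case: insubP => // u _ _; apply: ltnW.
Qed.

Lemma card_bmultinom d : (#|{: 'X_{1..N < d}}| <= d ^ N)%N.
Proof.
have -> : (d ^ N = #|{: {ffun 'I_N -> 'I_d}}|)%N by rewrite card_ffun !card_ord.
have bound (m : 'X_{1..N < d}) v : (m v < d)%N.
  by apply: leq_ltn_trans (bmdeg m); rewrite mdegE (bigD1 v) //= leq_addr.
apply: (@leq_card _ _ (fun m => [ffun v => Ordinal (bound m v)])) => m m' /ffunP mm'.
by apply/val_inj/mnmP => v; have := mm' v; rewrite !ffunE => -[].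
Qed.

(** Only finitely many monomials have degree below [d]: the coefficient matrix
    of [B] has independent rows and at most [d ^ N] columns. *)
Lemma independent_card I (J : finType) (B : J -> R) d :
    I 0 -> independent I B -> (forall j, (msize (B j) <= d)%N) ->
  (#|J| <= d ^ N)%N.
Proof.
move=> I0 indB szB; apply: leq_trans (card_bmultinom d).
pose A := \matrix_(i < #|J|, m < #|{: 'X_{1..N < d}}|)
            (B (enum_val i))@_(enum_val m : 'X_{1..N < d}).
suff /eqP <- : row_free A by apply: rank_leq_col.
apply/inj_row_free => v vA.
have p0 : \sum_j v 0 (enum_rank j) *: B j = 0.
  apply/mpolyP => m; rewrite mcoeff0 raddf_sum /=.
  have [md|md] := ltnP (mdeg m) d; last first.
    rewrite big1 // => j _; rewrite mcoeffZ memN_msupp_eq0 ?mulr0 //.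
    by apply: msize_mdeg_ge; apply: leq_trans md.
  have /rowP/(_ (enum_rank (BMultinom md))) := vA; rewrite !mxE => v0.
  rewrite -[RHS]v0 (reindex (@enum_val J predT)) /=; last first.
    by exists enum_rank => j _; rewrite ?enum_valK ?enum_rankK.
  by apply: eq_bigr => j _; rewrite mcoeffZ !mxE enum_valK enum_rankK.
apply/rowP => i; rewrite mxE -[i]enum_valK.
by apply: (indB (fun j => v 0 (enum_rank j))); rewrite p0.
Qed.

(** Products of powers of the elements of [s] and of the variables in [W], all
    exponents below [M], are independent.  The induction adds the elements of
    [s] from the last to the first, so that the ideal shrinks to zero. *)
Lemma regular_sequence_growth s (W : {set 'I_N}) :
    regular_sequence s ->
    (forall p : R, (forall m, m \in msupp p -> forall v, v \notin W -> m v = 0%N) ->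
      ideal_seq s p -> p = 0) ->
  exists c, forall M, exists (J : finType) (B : J -> R),
    [/\ independent (ideal_seq [::]) B, #|J| = (M ^ (size s + #|W|))%N &
        forall j, (msize (B j) <= c * M + c)%N].
Proof.
move=> [regs _] Ws.
suff H d : (d <= size s)%N -> exists c, forall M, exists (J : finType) (B : J -> R),
    [/\ independent (ideal_seq (take (size s - d) s)) B,
        #|J| = (M ^ (d + #|W|))%N & forall j, (msize (B j) <= c * M + c)%N].
  by have := H (size s) (leqnn _); rewrite subnn take0.
elim: d => [|d IH] ds.
  rewrite subn0 take_size; exists N.+1 => M.
  have [J [B [indB cJ szB]]] := independent_monomials M Ws.
  exists J, B; split=> // j; apply: leq_trans (szB j) _.
  by rewrite leq_add // leq_mul.
have [c Hc] := IH (ltnW ds).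
set i := (size s - d.+1)%N; have iE : (size s - d = i.+1)%N by rewrite /i subnSK.
have lt_is : (i < size s)%N by rewrite /i ltn_subrL (leq_ltn_trans _ ds).
exists (c + (msize s`_i).+2)%N => M; have [J [B [indB cJ szB]]] := Hc M.
exists ('I_M * J)%type, (fun j : 'I_M * J => s`_i ^+ j.1 * B j.2); split.
- apply: independent_powers indB => [p q|]; last exact: regs.
  rewrite iE (take_nth 0 lt_is) => Ipq.
  rewrite -(addrK (s`_i * q) p); apply: ideal_genB.
    apply: ideal_gen_sub Ipq => g gs; apply: ideal_gen_mem.
    by rewrite mem_rcons inE gs orbT.
  rewrite mulrC; apply/ideal_genM/ideal_gen_mem.
  by rewrite mem_rcons inE eqxx.
- by rewrite card_prod card_ord cJ -expnS.
move=> [e j] /=; rewrite (leq_trans (msizeM_le _ _)) //.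
apply: leq_trans (_ : (M * (msize s`_i).+1 + 1 + (c * M + c)).+1 <= _)%N.
  rewrite ltnS leq_add //; apply: leq_trans (msize_exp _ _) _.
  by rewrite leq_add2r leq_mul2r ltnW ?orbT.
by move: (msize _) => a; lia.
Qed.

(** If the variables in [W] are algebraically independent modulo [s], a regular
    sequence has length at most [N - |W|].  Otherwise at least [M ^ (N + 1)]
    independent polynomials would have degree at most linear in [M]. *)
Theorem regular_sequence_size_le s (W : {set 'I_N}) :
    regular_sequence s ->
    (forall p : R, (forall m, m \in msupp p -> forall v, v \notin W -> m v = 0%N) ->
      ideal_seq s p -> p = 0) ->
  (size s + #|W| <= N)%N.
Proof.
move=> regs Ws; have [c Hc] := regular_sequence_growth regs Ws.
rewrite leqNgt; apply/negP => ltN.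
(* Large enough for (c M + c) ^ N < M ^ (N + 1). *)
pose M := ((c + c) ^ N).+1; have [J [B [indB cJ szB]]] := Hc M.
have := independent_card (ideal_gen0 _) indB szB; rewrite cJ leqNgt => /negP; apply.
apply: (@leq_trans (M ^ N.+1)); last exact: leq_pexp2l.
apply: (@leq_ltn_trans ((c + c) ^ N * M ^ N)).
  have leM : (c * M + c <= (c + c) * M)%N by rewrite mulnDl leq_add2l leq_pmulr.
  by rewrite -expnMn; elim: (N) => // e IH; rewrite !(expnS _ e) leq_mul.
by rewrite expnS ltn_pmul2r ?expn_gt0.
Qed.

End Growth.

(** * The ideal of a linear forest is an intersection of primes *)

Section Param.
Local Open Scope ring_scope.
Variables (k : fieldType) (n : nat).
Local Notation R := {mpoly k[n + n]}.
Local Notation xv := (@xvar k n).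
Local Notation yv := (@yvar k n).
Local Notation dl := (@delta k n).
Implicit Types (T : {set 'I_n}) (r : 'I_n -> 'I_n) (m : 'X_{1..n + n}).

(** A point of the variety where the columns [(x_i, y_i)] vanish for [i] in [T]
    and are proportional when [r] agrees.  The scale factors are the [x_i]
    themselves and the common direction is [(1, y_(r i))], so no variables
    beyond the given ones are needed. *)
Definition param_point T r (v : 'I_(n + n)) : R :=
  match split v with
  | inl i => if i \in T then 0 else xv i
  | inr i => if i \in T then 0 else xv i * yv (r i)
  end.

Definition param T r : {rmorphism R -> R} := mmap (@mpolyC (n + n) k) (param_point T r).

Lemma param_pointl T r i : param_point T r (lshift n i) = if i \in T then 0 else xv i.
Proof. by rewrite /param_point (unsplitK (inl _ i)). Qed.

Lemma param_pointr T r i : param_point T r (rshift n i) = if i \in T then 0 else xv i * yv (r i).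
Proof. by rewrite /param_point (unsplitK (inr _ i)). Qed.

Lemma param_xvar T r i : param T r (xv i) = if i \in T then 0 else xv i.
Proof. by rewrite /= mmapX mmap1U param_pointl. Qed.

Lemma param_yvar T r i : param T r (yv i) = if i \in T then 0 else xv i * yv (r i).
Proof. by rewrite /= mmapX mmap1U param_pointr. Qed.

Lemma mpolyX_eq0 m : ('X_[m] == 0 :> R) = false.
Proof. by rewrite -msize_poly_eq0 msizeX. Qed.

Lemma param_delta_eq0 T r i j :
  (param T r (dl i j) == 0) = [|| i \in T, j \in T | r i == r j].
Proof.
rewrite /delta rmorphB !rmorphM !param_xvar !param_yvar.
case: (i \in T); first by rewrite !(mul0r, mulr0) subrr eqxx.
case: (j \in T); first by rewrite !(mul0r, mulr0) subrr eqxx.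
rewrite !mulrA [xv j * xv i]mulrC -mulrBr !mulf_eq0 !mpolyX_eq0 /= subr_eq0.
by apply/eqP/eqP => [/(congr1 (mcoeff U_(rshift n (r j))))|-> //];
   rewrite !mcoeffX eqxx; case: eqP => [/eqP|_ /eqP];
   rewrite ?oner_eq0 // eq_mnm1 => /eqP/rshift_inj ->.
Qed.

Definition supported_off T m :=
  [forall i in T, (m (lshift n i) == 0%N) && (m (rshift n i) == 0%N)].

(** The morphism maps monomials to monomials or to zero.  The image records
    the total degree at each vertex and the [y]-degree on each class of [r]. *)
Definition param_mnm r m : 'X_{1..n + n} := [multinom
  match split v with
  | inl i => (m (lshift n i) + m (rshift n i))%N
  | inr w => (\sum_(i | r i == w) m (rshift n i))%N
  end | v < n + n].

Lemma param_mnml r m i :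
  param_mnm r m (lshift n i) = (m (lshift n i) + m (rshift n i))%N.
Proof. by rewrite mnmE (unsplitK (inl _ i)). Qed.

Lemma param_mnmr r m w :
  param_mnm r m (rshift n w) = (\sum_(i | r i == w) m (rshift n i))%N.
Proof. by rewrite mnmE (unsplitK (inr _ w)). Qed.

Lemma param_monomial T r m :
  param T r 'X_[m] = if supported_off T m then 'X_[param_mnm r m] else 0.
Proof.
rewrite /= mmapX /mmap1; case: ifP => [/forall_inP off|/negbT]; last first.
  rewrite negb_forall_in => /exists_inP[i iT]; rewrite negb_and => /orP[] nz.
    by rewrite (bigD1 (lshift n i)) //= param_pointl iT expr0n (negPf nz) mul0r.
  by rewrite (bigD1 (rshift n i)) //= param_pointr iT expr0n (negPf nz) mul0r.
rewrite mpolyXE_id !big_split_ord /=.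
under eq_bigr => i _.
  have -> : param_point T r (lshift n i) ^+ m (lshift n i) = xv i ^+ m (lshift n i).
    by rewrite param_pointl; case: ifP => // /off/andP[/eqP-> _]; rewrite !expr0.
  over.
under [X in _ * X]eq_bigr => i _.
  have -> : param_point T r (rshift n i) ^+ m (rshift n i)
          = xv i ^+ m (rshift n i) * yv (r i) ^+ m (rshift n i).
    by rewrite param_pointr -exprMn; case: ifP => // /off/andP[_ /eqP->]; rewrite !expr0.
  over.
rewrite big_split mulrA -big_split /=; congr (_ * _).
  by apply: eq_bigr => i _; rewrite param_mnml exprD.
rewrite (partition_big r predT) //=; apply: eq_bigr => w _.
by rewrite param_mnmr expr_sum; apply: eq_bigr => i /eqP->.
Qed.

(** Where the map on monomials is injective, coefficients can be read off the
    image. *)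
Lemma param_coeff T r (p : R) m :
    supported_off T m ->
    (forall m', m' \in msupp p -> supported_off T m' ->
      param_mnm r m' = param_mnm r m -> m' = m) ->
  (param T r p)@_(param_mnm r m) = p@_m.
Proof.
move=> offm uniqm.
have -> : param T r p = \sum_(m' <- msupp p) p@_m' *: param T r 'X_[m'].
  rewrite {1}[p]mpolyE rmorph_sum; apply: eq_bigr => m' _.
  by rewrite -mul_mpolyC rmorphM /= mmapC mul_mpolyC.
have termE m' : m' \in msupp p ->
    (p@_m' *: param T r 'X_[m'])@_(param_mnm r m) = p@_m' * (m' == m)%:R.
  move=> pm'; rewrite mcoeffZ param_monomial; congr (_ * _).
  case: ifP => [offm'|offm']; last first.
    by rewrite mcoeff0; case: eqP offm' => // ->; rewrite offm.
  rewrite mcoeffX; congr (nat_of_bool _)%:R; apply/eqP/eqP => [|-> //].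
  exact: uniqm.
rewrite raddf_sum (eq_big_seq _ termE) {termE}.
have [pm|pm] := boolP (m \in msupp p).
  rewrite (bigD1_seq m) ?msupp_uniq //= eqxx mulr1 big1 ?addr0 // => m' /negPf->.
  by rewrite mulr0.
rewrite big_seq big1 ?memN_msupp_eq0 // => m' pm'.
by case: eqP => [mE|]; rewrite ?mulr0 // -mE pm' in pm *.
Qed.

Section Chains.
Variables (pos : 'I_n -> nat).
Hypothesis pos_inj : injective pos.
Implicit Types (L : seq ('I_n * 'I_n)).

Definition deltas L : seq R := [seq dl p.1 p.2 | p <- L].

(** The kernel of this morphism is the prime attached to [T]. *)
Definition cut_param L T := param T (fingraph.root (link (avoiding L T))).

Lemma cut_param_delta L T i j :
  (cut_param L T (dl i j) == 0) =
  [|| i \in T, j \in T | connect (link (avoiding L T)) i j].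
Proof. by rewrite param_delta_eq0 root_connect //; apply: link_sym. Qed.

Lemma cut_param_deltas L T f : ideal_seq (deltas L) f -> cut_param L T f = 0.
Proof.
apply: ideal_gen_ker => _ /mapP[[u v] uv ->]; apply/eqP.
rewrite cut_param_delta; case: (boolP (u \in T)) => //= uT.
case: (boolP (v \in T)) => //= vT.
by apply: connect1; rewrite /link /= avoidingP uv uT vT.
Qed.

(** The termination measure of the rewriting of [x_u y_v] to [x_v y_u], which
    moves a [y] one step to the left. *)
Definition yweight m := (\sum_v m (rshift n v) * pos v)%N.

Lemma yweightD m m' : yweight (m + m')%MM = (yweight m + yweight m')%N.
Proof.
by rewrite -big_split /=; apply: eq_bigr => v _; rewrite mnmDE mulnDl.
Qed.

Lemma yweightl u : yweight U_(lshift n u)%MM = 0%N.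
Proof.
by rewrite /yweight big1 // => v _; rewrite mnm1E eq_lrshift.
Qed.

Lemma yweightr u : yweight U_(rshift n u)%MM = pos u.
Proof.
rewrite /yweight (bigD1 u) //= mnm1E eqxx mul1n big1 ?addn0 // => v /negPf vu.
by rewrite mnm1E eq_rshift eq_sym vu.
Qed.

Definition standard_mnm L m := standard L (fun v => m (lshift n v)) (fun v => m (rshift n v)).

(** Rewriting changes a monomial by a multiple of [delta u v], and it keeps it a
    monomial. *)
Lemma standard_mnm_exists L m : steps pos L ->
  exists2 m', standard_mnm L m' & ideal_seq (deltas L) ('X_[m] - 'X_[m']).
Proof.
move=> sL; have [w] := ubnP (yweight m); elim: w m => // w IH m lt_mw.
have [/hasP[[u v] uv /= /andP[mu mv]]|/hasPn stdm] :=
  boolP (has (fun p => (0 < m (lshift n p.1)) && (0 < m (rshift n p.2)))%N L);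
  last first.
  exists m; last by rewrite subrr; apply: ideal_gen0.
  move=> u v uv mu; apply/eqP; rewrite -leqn0 leqNgt.
  by have := stdm _ uv; rewrite /= mu.
pose m0 := (m - (U_(lshift n u) + U_(rshift n v)))%MM.
have mE : m = (m0 + (U_(lshift n u) + U_(rshift n v)))%MM.
  apply/esym/submK/mnm_lepP => i; rewrite mnmDE !mnm1E.
  case: eqP => [<-|_]; first by rewrite eq_rlshift addn0.
  by case: eqP => [<-|].
pose m1 := (m0 + (U_(lshift n v) + U_(rshift n u)))%MM.
have [|m' stdm' Jm1] := IH m1.
  rewrite -ltnS (leq_trans _ lt_mw) // ltnS mE !yweightD !yweightl !yweightr !add0n.
  by rewrite (sL _ _ uv) addnS.
exists m' => //.
rewrite -(subrK 'X_[m1] 'X_[m]) -addrA; apply: ideal_genD => //.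
have -> : 'X_[m] - 'X_[m1] = 'X_[m0] * dl u v :> R.
  by rewrite {1}mE /m1 !mpolyXD mulrBr.
by apply/ideal_genM/ideal_gen_mem; apply/mapP; exists (u, v).
Qed.

Lemma standard_mpoly_exists L (f : R) : steps pos L ->
  exists2 g, forall m, m \in msupp g -> standard_mnm L m & ideal_seq (deltas L) (f - g).
Proof.
move=> sL; elim/mpolyind: f => [|c m f _ _ [g stdg Jfg]].
  by exists 0; [move=> m; rewrite msupp0|rewrite subrr; apply: ideal_gen0].
have [m' stdm' Jm] := standard_mnm_exists m sL; exists (c *: 'X_[m'] + g).
  move=> m2 /msuppD_le; rewrite mem_cat => /orP[/msuppZ_le|/stdg //].
  by rewrite msuppX inE => /eqP->.
rewrite opprD addrACA; apply: ideal_genD => //.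
by rewrite -scalerBr -mul_mpolyC; apply: ideal_genM.
Qed.

(** A monomial [m] of [g] is recovered from its image under the morphism for
    the gaps of its own support: other monomials of [g] go to zero or, by
    [standard_inj], to different monomials. *)
Lemma standard_mpoly_eq0 L (g : R) : steps pos L ->
    (forall m, m \in msupp g -> standard_mnm L m) ->
    (forall T, cutset L T -> cut_param L T g = 0) ->
  g = 0.
Proof.
move=> sL stdg ker; apply/eqP; rewrite -msupp_eq0; apply/contraT.
case E: (msupp g) => [//|m s] _.
have gm : m \in msupp g by rewrite E mem_head.
pose T := gaps L (fun v => 0 < m (lshift n v) + m (rshift n v))%N.
have offm : supported_off T m.
  apply/forall_inP => i; rewrite inE => /and3P[+ _ _].
  by rewrite -eqn0Ngt addn_eq0.
suff coef : (cut_param L T g)@_(param_mnm (fingraph.root (link (avoiding L T))) m) = g@_m.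
  move: gm; rewrite mcoeff_msupp -coef ker ?mcoeff0 ?eqxx //.
  exact: (cutset_gaps pos_inj _ sL).
apply: param_coeff => // m' gm' _ /mnmP mm'.
have sum_eq v : (m (lshift n v) + m (rshift n v) = m' (lshift n v) + m' (rshift n v))%N.
  by have := mm' (lshift n v); rewrite !param_mnml.
have yE : (fun v => m (rshift n v)) =1 (fun v => m' (rshift n v)).
  apply: (standard_inj pos_inj sL (stdg _ gm) (stdg _ gm') sum_eq) => w.
  by have := mm' (rshift n w); rewrite !param_mnmr.
apply/mnmP => v; case: (split_ordP v) => i ->; last by rewrite -yE.
by apply/eqP; rewrite -(eqn_add2r (m' (rshift n i))) -sum_eq yE.
Qed.

(** The ideal of the forest is the intersection of the primes of its cutsets, so
    every question about zero divisors is settled in these domains. *)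
Theorem deltas_radical L (f : R) : steps pos L ->
  (forall T, cutset L T -> cut_param L T f = 0) -> ideal_seq (deltas L) f.
Proof.
move=> sL ker; have [g stdg Jfg] := standard_mpoly_exists f sL.
suff g0 : g = 0 by rewrite g0 subr0 in Jfg.
apply: standard_mpoly_eq0 stdg _ => // T cT.
by rewrite -[g](subKr f) rmorphB ker // (cut_param_deltas T Jfg) subrr.
Qed.

Lemma deltas_nonzerodivisor L (g h : R) : steps pos L ->
    (forall T, cutset L T -> cut_param L T g != 0) ->
  ideal_seq (deltas L) (g * h) -> ideal_seq (deltas L) h.
Proof.
move=> sL nz Jgh; apply: deltas_radical => // T cT.
have /eqP := cut_param_deltas T Jgh.
by rewrite rmorphM mulf_eq0 (negPf (nz T cT)) => /eqP.
Qed.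

(** The next edge [u v] joins two components of the forest built so far, and
    [u] and [v] are not inner vertices of it; so [delta u v] lies in none of its
    primes. *)
Lemma deltas_regular L : uniq L -> steps pos L ->
  forall i, (i < size (deltas L))%N -> forall g,
    ideal_seq (take i (deltas L)) ((deltas L)`_i * g) ->
    ideal_seq (take i (deltas L)) g.
Proof.
move=> uL sL i; rewrite size_map => lt_i g; rewrite -map_take.
case E : L => [|p0 L0]; first by rewrite E in lt_i.
rewrite -E (nth_map p0) //; case uv : (nth p0 L i) => [u v] /=.
have sLi : steps pos (take i L) by apply: steps_sub sL => p /mem_take.
have uvL : (u, v) \in L by rewrite -uv mem_nth.
have uvN : (u, v) \notin take i L.
  apply/negP => /(nthP p0)[j]; rewrite size_take lt_i => lt_ji.
  rewrite nth_take // -uv => /eqP; rewrite nth_uniq // ?(ltn_trans lt_ji) //.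
  by move/eqP=> ji; rewrite ji ltnn in lt_ji.
have succ_uniq w : (u, w) \in take i L -> w = v.
  by move=> uw; apply: pos_inj; rewrite (sLi _ _ uw) (sL _ _ uvL).
have pred_uniq w : (w, v) \in take i L -> w = u.
  move=> wv; apply: pos_inj; apply/eqP.
  by rewrite -eqSS -(sLi _ _ wv) (sL _ _ uvL).
apply: deltas_nonzerodivisor => // T [hl hr ind]; rewrite cut_param_delta.
apply/negP => /or3P[/hr[w uw]|/hl[w wv]|].
- by rewrite -(succ_uniq w uw) uw in uvN.
- by rewrite -(pred_uniq w wv) wv in uvN.
rewrite link_sym => vu.
have v_left : v \in leftmost (avoiding (take i L) T).
  rewrite inE; apply/mapP => -[[w z]]; rewrite avoidingP /= => /and3P[wv _ _] zE.
  by rewrite -zE in wv; rewrite -(pred_uniq _ wv) wv in uvN.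
have := leftmost_connect_le pos_inj (steps_avoiding sLi) v_left vu.
by rewrite (sL _ _ uvL) ltnn.
Qed.

End Chains.
End Param.

(** * Prime avoidance *)

Section Avoidance.
Local Open Scope ring_scope.
Variables (k : fieldType) (N : nat) (X : eqType).
Local Notation R := {mpoly k[N]}.
Variables (A : R -> Prop) (Phi : X -> {rmorphism R -> R}) (z : R).

(** If [g] is good for all but the first morphism, where it vanishes, and [h] is
    good for the first one, then [g + z ^ d * h] is good for all of them once
    [d] exceeds the degrees of the images of [g].  Powers of an element [z] of
    nonconstant image play the role of generic scalars, so finite fields need no
    separate treatment. *)
Lemma prime_avoidance (Ts : seq X) :
    (forall T, T \in Ts -> (1 < msize (Phi T z))%N) ->
    (forall T, T \in Ts -> exists2 h, ideal_gen A h & Phi T h != 0) ->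
  exists2 g, ideal_gen A g & forall T, T \in Ts -> Phi T g != 0.
Proof.
elim: Ts => [|T Ts IH] zP hP; first by exists 0; [apply: ideal_gen0|].
have sub T' : T' \in Ts -> T' \in T :: Ts by rewrite inE orbC => ->.
have [||g Ag gP] := IH; [by move=> T' /sub/zP|by move=> T' /sub/hP|].
have [gT|gT] := eqVneq (Phi T g) 0; last first.
  by exists g => // T'; rewrite inE => /orP[/eqP->|/gP].
have [h Ah hT] := hP T (mem_head _ _).
have nz T' : T' \in T :: Ts -> Phi T' z != 0.
  by move/zP; apply: contraTneq => ->; rewrite msize0.
pose d := (\sum_(T' <- Ts) msize (Phi T' g))%N.
exists (g + z ^+ d * h) => [|T'].
  by apply: ideal_genD => //; apply: ideal_genM.
rewrite inE rmorphD rmorphM rmorphXn => /predU1P[->|T'Ts].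
  by rewrite gT add0r mulf_neq0 // expf_neq0 // nz ?mem_head.
have [->|hT'] := eqVneq (Phi T' h) 0; first by rewrite mulr0 addr0 gP.
have size_pow : (d < msize (Phi T' z ^+ d * Phi T' h)%R)%N.
  elim: (d) => [|e IHe]; first by rewrite expr0 mul1r lt0n msize_poly_eq0.
  have zT' := sub _ T'Ts.
  rewrite exprS -mulrA msizeM ?nz ?mulf_neq0 ?expf_neq0 ?nz //.
  by have := zP _ zT'; case: (msize (Phi T' z)) => [|[|s]] // _; rewrite !addSn /= ltnS ltn_addl.
rewrite addr_eq0; apply: contraTneq size_pow => /(congr1 (fun p => msize p)).
by rewrite msizeN => <-; rewrite -leqNgt /d (big_rem T') //= leq_addr.
Qed.

End Avoidance.

(** * Koenig type and covers *)

Section Main.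
Local Open Scope ring_scope.
Variables (k : fieldType) (n : nat).
Local Notation R := {mpoly k[n + n]}.
Variables (G F : graph 'I_n) (pos : 'I_n -> nat) (L : seq ('I_n * 'I_n)).
Hypotheses (maxF : maximal_linear_forest G F) (lay : layout F pos L).
Let pos_inj : injective pos. Proof. by case: lay. Qed.
Let uL : uniq L. Proof. by case: lay. Qed.
Let sL : steps pos L. Proof. by case: lay. Qed.

Lemma LF_size : LF G = size L.
Proof. by rewrite (maximal_LF maxF); case: lay. Qed.

Lemma delta_anti (i j : 'I_n) : delta k j i = - delta k i j.
Proof. by rewrite /delta opprB. Qed.

Lemma delta_mem i j : adj G i j -> binomial_edge_ideal (k := k) G (delta k i j).
Proof.
move=> ij; case: (ltngtP i j) => [lt|lt|/val_inj eij].
- by apply: ideal_gen_mem; exists i, j.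
- rewrite delta_anti -mulN1r; apply/ideal_genM/ideal_gen_mem.
  by exists j, i; rewrite adj_sym.
by rewrite eij adj_irr in ij.
Qed.

Lemma deltas_mem f : f \in deltas k L -> binomial_edge_ideal (k := k) G f.
Proof.
case/mapP => -[u v] uv ->; apply: delta_mem.
case: maxF => /andP[/andP[_ /subsetP sub] _] _; apply: sub.
rewrite -[_ \in _]/(adj F u v); case: lay => _ _ _ -> _.
by rewrite /link /= uv.
Qed.

Lemma binomial_edge_ideal_ker (phi : {rmorphism R -> R}) :
    (forall i j, adj G i j -> phi (delta k i j) = 0) ->
  forall f, binomial_edge_ideal G f -> phi f = 0.
Proof. by move=> phi0 f; apply: ideal_gen_ker => _ [i [j [_ /phi0 ? ->]]]. Qed.

(** The origin is a common zero. *)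
Lemma binomial_edge_ideal_proper : ~ binomial_edge_ideal G (1 : R).
Proof.
move=> J1; have /eqP : param k [set: 'I_n] id 1 = 0.
  apply: binomial_edge_ideal_ker J1 => i j _.
  by apply/eqP; rewrite param_delta_eq0 inE.
by rewrite rmorph1 oner_eq0.
Qed.

Lemma regular_in_ideal (s : seq R) :
    (forall f, f \in s -> binomial_edge_ideal G f) ->
    (forall i, (i < size s)%N -> forall g,
      ideal_seq (take i s) (s`_i * g) -> ideal_seq (take i s) g) ->
  regular_sequence s.
Proof.
move=> sG reg; split=> // /(ideal_gen_sub sG); exact: binomial_edge_ideal_proper.
Qed.

Lemma deltas_regular_sequence : regular_sequence (deltas k L).
Proof. exact: regular_in_ideal deltas_mem (deltas_regular pos_inj uL sL). Qed.

Section UpperBound.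
Variable S : {set 'I_n}.
Hypothesis cutS : cutset L S.
Hypothesis cov : forall i j, adj G i j ->
  [\/ i \in S, j \in S | connect (link (avoiding L S)) i j].

Let M := avoiding L S.
Let B := leftmost M :\: S.
(* The variables that stay independent: every x_i off S, and one y_i for each
   component of F without S. *)
Let free : {set 'I_(n + n)} := [set v |
  match split v with inl i => i \notin S | inr i => i \in B end].

Lemma freel i : (lshift n i \in free) = (i \notin S).
Proof. by rewrite inE (unsplitK (inl _ i)). Qed.

Lemma freer i : (rshift n i \in free) = (i \in B).
Proof. by rewrite inE (unsplitK (inr _ i)). Qed.

(** With [c] components of the forest outside [S] there are [n - |S| + c] free
    variables, and [c = n - |S| - (size L - 2|S|)]. *)
Lemma card_free : (n + n <= #|free| + size L)%N.
Proof.
have -> : #|free| = (#|~: S| + #|B|)%N.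
  rewrite -!sum1_card big_mkcond big_split_ord /=; congr (_ + _)%N.
    by rewrite [RHS]big_mkcond; apply: eq_bigr => i _; rewrite freel !inE.
  by rewrite [RHS]big_mkcond; apply: eq_bigr => i _; rewrite freer.
have cM := card_leftmost pos_inj (filter_uniq _ uL : uniq M) (steps_avoiding sL).
rewrite card_ord in cM.
have cS := cardsC S; rewrite card_ord in cS.
have cB : (#|leftmost M| <= #|B| + #|S|)%N.
  by rewrite -(cardsID S (leftmost M)) addnC leq_add2l subset_leq_card ?subsetIr.
have cL := cutset_size pos_inj uL sL cutS; rewrite -/M in cL.
move: cM cS cB cL; rewrite -/M.
move: #|leftmost M| (size M) #|S| #|~: S| #|B| (size L) => a b c d e f.
by lia.
Qed.

(** Each class of the parametrization contains one free [y_i], so the [y]-degree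
    on the class is the exponent of [y_i], and the degree at [i] then gives the
    exponent of [x_i]. *)
Lemma free_inj (p : R) :
    (forall m, m \in msupp p -> forall v, v \notin free -> m v = 0%N) ->
    cut_param k L S p = 0 ->
  p = 0.
Proof.
move=> freep p0; apply/mpolyP => m; rewrite mcoeff0.
have [pm|/memN_msupp_eq0 //] := boolP (m \in msupp p).
have offS m' : m' \in msupp p -> supported_off S m'.
  move=> pm'; apply/forall_inP => i iS.
  by rewrite !(freep _ pm') ?freel ?freer ?inE ?iS.
rewrite -(@param_coeff _ _ S (fingraph.root (link M)) _ _ (offS _ pm)).
  by rewrite -/M -[param _ _ _]/(cut_param k L S) p0 mcoeff0.
move=> m' pm' _ /mnmP mm'.
have yE i : m' (rshift n i) = m (rshift n i).
  have [iB|iB] := boolP (i \in B); last first.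
    by rewrite !freep ?freer.
  have one q : q \in msupp p ->
      param_mnm (fingraph.root (link M)) q (rshift n (fingraph.root (link M) i))
      = q (rshift n i).
    move=> pq; rewrite param_mnmr (bigD1 i) //= big1 ?addn0 // => j /andP[rj ji].
    apply: freep => //; rewrite freer.
    apply: contra ji => jB; move: iB jB; rewrite !inE => /andP[_ iM] /andP[_ jM].
    apply/eqP/(leftmost_connect_eq pos_inj (steps_avoiding (S := S) sL)); rewrite ?inE //.
    by rewrite -(root_connect (link_sym _)).
  by rewrite -(one m' pm') -(one m pm).
apply/mnmP => v; case: (split_ordP v) => i -> //.
by have := mm' (lshift n i); rewrite !param_mnml yE => /addIn.
Qed.

Lemma cover_bound (s : seq R) :
  regular_sequence s -> (forall f, f \in s -> binomial_edge_ideal G f) ->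
  (size s <= size L)%N.
Proof.
move=> regs sG.
rewrite -(leq_add2l #|free|) addnC; apply: leq_trans card_free.
apply: regular_sequence_size_le regs _ => p freep sp; apply: free_inj => //.
apply: (binomial_edge_ideal_ker (phi := cut_param k L S)); last exact: ideal_gen_sub sp.
move=> i j ij; apply/eqP; rewrite cut_param_delta.
by case: (cov ij) => ->; rewrite ?orbT.
Qed.

End UpperBound.

Lemma cover_konig S : LF_cover G F S -> konig_type k G.
Proof.
case/(LF_cover_layout lay) => _ cS cov; rewrite /konig_type LF_size; split.
  exists (deltas k L); split; [exact: deltas_regular_sequence|exact: deltas_mem|].
  exact: size_map.
exact: cover_bound cS cov.
Qed.

Hypothesis n_gt0 : (0 < n)%N.

(** The neighbour of a vertex of a cutset lies outside it. *)
Lemma cutset_proper T : cutset L T -> exists i, i \notin T.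
Proof.
case=> hl _ ind; have [i0 i0T|T0] := pickP (fun i => i \in T); last first.
  by exists (Ordinal n_gt0); rewrite T0.
have [u ui] := hl _ i0T; exists u; apply/negP => uT.
by have := ind _ _ ui uT; rewrite i0T.
Qed.

(* Nonconstant under every parametrization, as required for avoidance. *)
Let z : R := \sum_i xvar k i.

Lemma cut_param_z T : cutset L T -> (1 < msize (cut_param k L T z))%N.
Proof.
case/cutset_proper => i iT.
suff /msize_mdeg_lt : U_(lshift n i)%MM \in msupp (cut_param k L T z).
  by rewrite mdeg1.
rewrite mcoeff_msupp rmorph_sum raddf_sum (bigD1 i) //= param_xvar (negPf iT).
rewrite mcoeffX eqxx big1 ?addr0 ?oner_eq0 // => j ji.
rewrite param_xvar; case: ifP; rewrite ?mcoeff0 // mcoeffX eq_mnm1 eq_lshift.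
by rewrite (negPf ji).
Qed.

(** If no cutset covers [G], an element of the ideal avoiding all the primes
    extends the regular sequence of the forest by one. *)
Lemma konig_cover : konig_type k G -> LF_coverable G.
Proof.
rewrite /konig_type LF_size => -[_ bound].
have [/existsP[S /andP[/cutsetbP cS /forallP cov]]|nocov] := boolP [exists S, cutsetb L S &&
  [forall i, [forall j, adj G i j ==>
    [|| i \in S, j \in S | connect (link (avoiding L S)) i j]]]].
  exists F, S; apply/(LF_cover_layout lay); split=> // i j ij.
  have /forallP/(_ j) := cov i; rewrite ij /= => /or3P.
  by case=> h; [constructor 1|constructor 2|constructor 3].
have bad T : T \in enum (cutsetb L) -> exists2 h : R, binomial_edge_ideal G h
    & cut_param k L T h != 0.
  rewrite mem_enum => cT; move: nocov; rewrite negb_exists => /forallP/(_ T).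
  rewrite [cutsetb L T]cT /= negb_forall => /existsP[i].
  rewrite negb_forall => /existsP[j]; rewrite negb_imply => /andP[ij nij].
  by exists (delta k i j); [apply: delta_mem|rewrite cut_param_delta].
have zP T : T \in enum (cutsetb L) -> (1 < msize (cut_param k L T z))%N.
  by rewrite mem_enum => /cutsetbP/cut_param_z.
have [g Gg gP] := prime_avoidance zP bad.
pose s := rcons (deltas k L) g.
have szs : size s = (size L).+1 by rewrite size_rcons size_map.
have sG f : f \in s -> binomial_edge_ideal G f.
  by rewrite mem_rcons inE => /predU1P[->|/deltas_mem].
suff /bound : regular_sequence s by rewrite szs ltnn => /(_ sG).
apply: regular_in_ideal => // i; rewrite szs ltnS leq_eqVlt => /predU1P[->|lt_i] h.
  rewrite /s -cats1 take_size_cat ?size_map // nth_cat size_map ltnn subnn.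
  apply: (deltas_nonzerodivisor pos_inj sL) => T cT; apply: gP.
  by rewrite mem_enum; apply/cutsetbP.
rewrite /s nth_rcons size_map lt_i -cats1 takel_cat ?size_map 1?ltnW //.
by apply: (deltas_regular pos_inj uL sL); rewrite size_map.
Qed.

End Main.

Theorem theorem2p10 (k : fieldType) (n : nat) (hn : 1 < n)
    (G : graph 'I_n) (hG : verts G = [set: 'I_n]) :
  (konig_type k G <-> LF_coverable G) /\
  (forall S : {set 'I_n}, S \subset verts G ->
   forall F F' : graph 'I_n,
     maximal_linear_forest G F -> maximal_linear_forest G F' ->
     (LF_cover G F S <-> LF_cover G F' S)).
Proof.
split; last by move=> S _ F F' mF mF'; split; apply: LF_cover_transfer.
split=> [|[F [S cov]]].
  have [F mF _] := ex_maximal_linear_forest G.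
  have [/andP[_ /linear_forest_layout[pos [L lay]]] _] := mF.
  exact: konig_cover mF lay (ltnW hn).
have [mF _ _ _ _] := cov; have [/andP[_ /linear_forest_layout[pos [L lay]]] _] := mF.
exact: (cover_konig k mF lay cov).
Qed.
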